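(* Every minimum edge cut in a non-collinear visibility graph is the set of edges incident to some vertex.
   Context: For a finite set $P$ of points in the plane, two distinct points $v,w$ are visible with respect to $P$ if no point of $P$ lies in the open line segment $vw$. The visibility graph of $P$ has vertex set $P$, with $v,w$ adjacent iff they are visible with respect to $P$. A visibility graph is non-collinear if $P$ does not lie on a single line. A minimum edge cut is an edge cut (set of edges whose removal disconnects the graph) of minimum size. *)

(* Defs.v *)
From HB Require Import structures.
From mathcomp Require Import all_boot all_order all_algebra.
From mathcomp Require Import finmap boolp reals.

Set Implicit Arguments.
Unset Strict Implicit.
Unset Printing Implicit Defensive.

Import Order.TTheory GRing.Theory Num.Theory.

Local Open Scope ring_scope.

Section Graph.
Variable T : finType.

(* A simple graph on T is a symmetric irreflexive relation; an edge is the
   two-element set of its ends. *)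
Definition edges (e : rel T) : {set {set T}} :=
  [set [set x.1; x.2] | x in [pred x : T * T | e x.1 x.2]].

Definition remove_edges (e : rel T) (F : {set {set T}}) : rel T :=
  [rel x y | e x y && ([set x; y] \notin F)].

Definition connected_graph (e : rel T) : Prop := forall x y : T, connect e x y.

Definition edge_cut (e : rel T) (F : {set {set T}}) : Prop :=
  F \subset edges e /\ ~ connected_graph (remove_edges e F).

Definition minimum_edge_cut (e : rel T) (F : {set {set T}}) : Prop :=
  edge_cut e F /\
  forall F' : {set {set T}}, edge_cut e F' -> (#|F| <= #|F'|)%N.

Definition incident_edges (e : rel T) (v : T) : {set {set T}} :=
  [set E in edges e | v \in E].

End Graph.

Section Visibility.
Variable R : realType.

Local Notation point := 'rV[R]_2.

Definition in_open_segment (v w z : point) : Prop :=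
  exists t : R, 0 < t < 1 /\ z = (1 - t) *: v + t *: w.

Definition collinear (P : {fset point}) : Prop :=
  exists a d : point, d != 0 /\
    forall z, z \in P -> exists t : R, z = a + t *: d.

Definition visible (P : {fset point}) (v w : point) : Prop :=
  v != w /\ forall z, z \in P -> ~ in_open_segment v w z.

Definition visibility_graph (P : {fset point}) : rel P :=
  fun v w => `[< visible P (val v) (val w) >].

End Visibility.

(* Main.v *)
Require Import Defs.
From mathcomp Require Import all_boot all_order all_algebra.
From mathcomp Require Import finmap boolp reals.
From mathcomp Require Import zify ring lra.

(** A minimum edge cut [F] is the boundary of some vertex set [A]; let [B] be
    its complement, and suppose that both have at least two vertices.  The
    graph has diameter at most 2, so one side, say [A], has all its vertices
    adjacent to the other side.  Since [#|F|] is at most every degree, counting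
    forces [#|F| = #|A| <= #|B|], makes [A] a clique, and gives every [a] in [A]
    exactly one neighbour [n a] in [B].

    Hence no three points of [A] are collinear, and every [b] in [B] either
    lies on the ray from [a] through [n a] (write [b] in [shadow a]) or is
    hidden from [a] by a unique [a'] in [A], and then [b] is in [shadow a'].
    A point [a'] hides points from at most one [a], and two shadows share at
    most one point.  If some shadow is all of [B], the other ones are
    singletons, and counting hiding points gives [#|B| < #|A|].  Otherwise every
    [a] has a hiding point [g a]; then [g] is a permutation of [A], and [B] is the
    disjoint union of [shadow a] and [shadow (g a)].  So [a] and [g (g a)] have
    equal shadows, which forces [g (g a) = a]: all of [B] lies on the line
    through [a] and [g a].  This holds for every [a], so all points are
    collinear. *)

Set Implicit Arguments.
Unset Strict Implicit.
Unset Printing Implicit Defensive.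

Import Order.TTheory GRing.Theory Num.Theory.

(** * Edge cuts as boundaries of vertex sets *)

Section EdgeCuts.
Variables (T : finType) (e : rel T).
Hypotheses (e_sym : symmetric e) (e_irr : irreflexive e).
Implicit Types (A : {set T}) (F : {set {set T}}) (v w : T).

Definition boundary A : {set {set T}} :=
  [set [set p.1; p.2] | p in [set p : T * T | [&& p.1 \in A, p.2 \notin A & e p.1 p.2]]].

Definition nbrs_in A v : {set T} := [set w in A | e v w].

Lemma boundaryP A E : reflect
  (exists v w, [/\ v \in A, w \notin A, e v w & E = [set v; w]]) (E \in boundary A).
Proof.
apply: (iffP imsetP) => [[[v w]]|[v [w [vA wA vw ->]]]].
  by rewrite inE => /and3P[/= vA wA vw] ->; exists v, w.
by exists (v, w); rewrite // inE /= vA wA.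
Qed.

Lemma edgesP E : reflect (exists v w, e v w /\ E = [set v; w]) (E \in edges e).
Proof.
apply: (iffP imsetP) => [[[v w]]|[v [w [vw ->]]]].
  by rewrite inE /= => vw ->; exists v, w.
by exists (v, w).
Qed.

Lemma boundaryC A : boundary (~: A) = boundary A.
Proof.
have sub B : boundary (~: B) \subset boundary B.
  apply/subsetP => E /boundaryP[v [w [vB wB vw ->]]]; apply/boundaryP.
  by exists w, v; rewrite e_sym setUC; split=> //; move: vB wB; rewrite !inE ?negbK.
apply/eqP; rewrite eqEsubset sub /=.
by have := sub (~: A); rewrite setCK.
Qed.

Lemma boundary1 v : boundary [set v] = incident_edges e v.
Proof.
apply/setP => E; rewrite inE; apply/boundaryP/andP.
  move=> [x [y [/set1P -> _ vy ->]]]; rewrite !inE eqxx; split => //.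
  by apply/edgesP; exists v, y.
have loop x y : e x y -> y \notin [set x].
  by rewrite inE; apply: contraTneq => ->; rewrite e_irr.
move=> [/edgesP[x [y [xy ->]]]]; rewrite !inE => /orP[] /eqP ->.
  by exists x, y; rewrite inE eqxx loop.
by exists y, x; rewrite setUC inE eqxx loop e_sym.
Qed.

(** An edge of the boundary has only one end in [A], so it determines its ordered pair of ends; the
    pairs are then counted by first component. *)
Lemma card_boundary A : #|boundary A| = \sum_(v in A) #|nbrs_in (~: A) v|.
Proof.
rewrite card_in_imset; last first.
  move=> [v w] [v' w']; rewrite !inE => /and3P[/= vA wA _] /and3P[/= v'A w'A _] E.
  have : v \in [set v'; w'] by rewrite -E !inE eqxx.
  have : w \in [set v'; w'] by rewrite -E !inE eqxx orbT.
  rewrite !inE => /orP[/eqP Ew|/eqP ->]; first by rewrite Ew v'A in wA.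
  by move=> /orP[/eqP -> //|/eqP Ev]; rewrite -Ev vA in w'A.
rewrite -sum1_card (eq_bigl (fun p : T * T => (p.1 \in A) && (p.2 \in nbrs_in (~: A) p.1))); last first.
  by move=> [v w]; rewrite !inE.
rewrite -(pair_big_dep (fun v => v \in A) (fun v w => w \in nbrs_in (~: A) v) (fun _ _ => 1%N)) /=.
by apply: eq_bigr => v _; rewrite sum1_card.
Qed.

Lemma boundary_edge_cut A v w : v \in A -> w \notin A -> edge_cut e (boundary A).
Proof.
move=> vA wA; split.
  apply/subsetP => E /boundaryP[x [y [_ _ xy ->]]]; by apply/edgesP; exists x, y.
move=> /(_ v w)/connectP[p]; elim: p v vA => [|z p IH] v vA /=.
  by move=> _ E; rewrite E vA in wA.
move=> /andP[/andP[vz /negP nb]]; apply: IH.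
by apply: contra_notT nb => zA; apply/boundaryP; exists v, z.
Qed.

(** Take for [A] the component of a vertex [x] once [F] is removed. Every edge leaving [A] is in
    [F], and these edges already form a cut, so minimality gives equality. *)
Lemma minimum_edge_cut_boundary F : minimum_edge_cut e F ->
  exists A, [/\ A != set0, ~: A != set0 & F = boundary A].
Proof.
move=> [[Fe nconn] minF].
have [x [y nxy]] : exists x y, ~~ connect (remove_edges e F) x y.
  apply: contrapT => nex; apply: nconn => x y; apply: contraT => nxy.
  by case: nex; exists x, y.
pose A := [set z | connect (remove_edges e F) x z].
have xA : x \in A by rewrite inE.
have yA : y \notin A by rewrite inE.
exists A; split.
- by apply/set0Pn; exists x.
- by apply/set0Pn; exists y; rewrite inE.
apply/eqP; rewrite eq_sym eqEcard minF; last exact: boundary_edge_cut xA yA.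
rewrite andbT; apply/subsetP => E /boundaryP[v [w [vA wA vw ->]]].
apply: contraNT wA => nF; move: vA; rewrite !inE => vA.
by apply: (connect_trans vA); apply: connect1; rewrite /remove_edges /= vw.
Qed.

Lemma minimum_edge_cut_degree F v w : minimum_edge_cut e F -> v != w ->
  #|F| <= #|nbrs_in setT v|.
Proof.
move=> [_ minF] vw; have vv : v \in [set v] by rewrite inE.
have wv : w \notin [set v] by rewrite inE eq_sym.
apply: leq_trans (minF _ (boundary_edge_cut vv wv)) _.
rewrite card_boundary big_set1; apply: subset_leq_card.
by apply/subsetP => z; rewrite !inE => /andP[].
Qed.

(** * Degree counting when the boundary is no larger than any degree *)

Section SmallBoundary.
Variable A : {set T}.
Hypothesis min_deg : forall v, #|boundary A| <= #|nbrs_in setT v|.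

Lemma card_nbrs_split v : #|nbrs_in setT v| = #|nbrs_in A v| + #|nbrs_in (~: A) v|.
Proof.
rewrite -(cardsID A); congr addn; apply: eq_card => w; rewrite !inE //=.
by rewrite andbC.
Qed.

Lemma nbrs_in_sub v : nbrs_in A v \subset A :\ v.
Proof.
apply/subsetP => w; rewrite !inE => /andP[-> vw]; rewrite andbT.
by apply: contraTneq vw => ->; rewrite e_irr.
Qed.

Lemma boundary_bound v : v \in A -> #|boundary A| < #|A| + #|nbrs_in (~: A) v|.
Proof.
move=> vA; apply: leq_ltn_trans (min_deg v) _; rewrite card_nbrs_split ltn_add2r.
by apply: leq_ltn_trans (subset_leq_card (nbrs_in_sub v)) _; rewrite [ltnRHS](cardsD1 v) vA.
Qed.

(* Summing [boundary_bound] over [A]. *)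
Lemma card_boundary_le : 1 < #|A| -> #|boundary A| <= #|A|.
Proof.
move=> A1.
have : \sum_(v in A) #|boundary A|.+1 <= \sum_(v in A) (#|A| + #|nbrs_in (~: A) v|).
  by apply: leq_sum => v; exact: boundary_bound.
rewrite big_split /= -card_boundary !sum_nat_const mulnS => h.
have A0 : 0 < #|A|.-1 by lia.
(* With [m] boundary edges and [k] vertices in [A], [h] reads [k + k m <= k k + m], that is
   [(k - 1) m <= (k - 1) k]. *)
rewrite -(leq_pmul2l A0); move: h A1; move: #|boundary A| #|A| => m [|k] //= h _. nia.
Qed.

(** Each vertex of [A] contributes at least one edge to a boundary of size at most [#|A|], hence
    exactly one. The degree bound then leaves [#|A| - 1] neighbours inside [A], which is all of
    them. *)
Lemma matching_boundary :
  1 < #|A| -> {in A, forall v, 0 < #|nbrs_in (~: A) v|} ->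
  [/\ #|boundary A| = #|A|, {in A &, forall v w, v != w -> e v w}
    & {in A, forall v, #|nbrs_in (~: A) v| = 1}].
Proof.
move=> A1 nb.
have leA := card_boundary_le A1.
have geA : #|A| <= #|boundary A|.
  by rewrite card_boundary -sum1_card; apply: leq_sum.
have eqA : #|boundary A| = #|A| by apply/eqP; rewrite eqn_leq leA.
have one : {in A, forall v, #|nbrs_in (~: A) v| = 1}.
  move=> v vA; apply/eqP; rewrite eqn_leq nb // andbT.
  have : \sum_(w in A :\ v) 1 <= \sum_(w in A :\ v) #|nbrs_in (~: A) w|.
    by apply: leq_sum => w /setD1P[_ wA]; exact: nb.
  move: eqA; rewrite card_boundary -[RHS]sum1_card !(big_setD1 v vA) /=; lia.
split=> // v w vA wA vw.
have : nbrs_in A v == A :\ v.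
  rewrite eqEcard nbrs_in_sub; have := min_deg v.
  by rewrite card_nbrs_split one // eqA (cardsD1 v A) vA; lia.
by move=> /eqP/setP/(_ w); rewrite !inE wA eq_sym vw.
Qed.

End SmallBoundary.
End EdgeCuts.

Local Open Scope ring_scope.

(** * Betweenness and collinearity in the plane *)

Section Betweenness.
Variable R : realType.
Implicit Types (o d v w x y z : 'rV[R]_2) (s t : R).

Lemma open_segment_line o d s t r : s < t < r ->
  in_open_segment (o + s *: d) (o + r *: d) (o + t *: d).
Proof.
move=> /andP[st tr]; have r0 : r - s != 0 by apply/negP => /eqP; lra.
exists ((t - s) / (r - s)); split.
  rewrite divr_gt0 ?ltr_pdivrMr; lra.
by apply/rowP => i; rewrite !mxE; field.
Qed.

Lemma open_segment_sym v w z : in_open_segment v w z -> in_open_segment w v z.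
Proof.
case=> t [t01 ->]; exists (1 - t); split; first lra.
by apply/rowP => i; rewrite !mxE; ring.
Qed.

Lemma open_segmentE v w z : in_open_segment v w z ->
  exists2 t, 0 < t < 1 & z = v + t *: (w - v).
Proof.
by case=> t [t01 ->]; exists t => //; apply/rowP => i; rewrite !mxE; ring.
Qed.

Lemma line_at0 v d : v = v + 0 *: d.
Proof. by rewrite scale0r addr0. Qed.

Lemma line_at1 v w : w = v + 1 *: (w - v).
Proof. by rewrite scale1r addrC subrK. Qed.

Lemma open_segment_ray v d s t : 0 < s < t ->
  in_open_segment v (v + t *: d) (v + s *: d).
Proof. by move/(open_segment_line v d); rewrite scale0r addr0. Qed.

Lemma open_segment_trichotomy v w x y :
  in_open_segment v w x -> in_open_segment v w y ->
  [\/ x = y, in_open_segment v y x | in_open_segment v x y].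
Proof.
move=> /open_segmentE[s s01 ->] /open_segmentE[t t01 ->].
case: (ltgtP s t) => st; [apply: Or32 | apply: Or33 | by apply: Or31; rewrite st];
  apply: open_segment_ray; lra.
Qed.

Lemma open_segment_shorten v w x y :
  in_open_segment v w x -> in_open_segment x w y -> in_open_segment v y x.
Proof.
move=> /open_segmentE[s s01 ->] /open_segmentE[t t01 ->].
have -> : v + s *: (w - v) + t *: (w - (v + s *: (w - v))) =
    v + (s + t * (1 - s)) *: (w - v) by apply/rowP => i; rewrite !mxE; ring.
apply: open_segment_ray; nra.
Qed.

Lemma open_segment_extend v w x y :
  in_open_segment v y x -> in_open_segment x w y -> in_open_segment v w x.
Proof.
move=> /open_segmentE[s s01 ->] /open_segmentE[t t01 E].
have t0 : t != 0 by apply/negP => /eqP; lra.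
(* Here [w = x + (y - x) / t], and [y - x = (1 - s) (y - v)]. *)
have -> : w = v + (s + (1 - s) / t) *: (y - v).
  apply/rowP => i; have /rowP/(_ i) := E; rewrite !mxE => Ei.
  have tE : t * (s + (1 - s) / t) = t * s + (1 - s) by field.
  by apply: (mulfI t0); rewrite mulrDr mulrA tE; lra.
apply: open_segment_ray.
have : 0 < (1 - s) / t by rewrite divr_gt0; lra.
lra.
Qed.

Lemma open_segment_trans v w x y :
  in_open_segment v w y -> in_open_segment v y x -> in_open_segment v w x.
Proof.
move=> /open_segmentE[s s01 ->] /open_segmentE[t t01 ->].
have -> : v + t *: (v + s *: (w - v) - v) = v + (t * s) *: (w - v)
  by apply/rowP => i; rewrite !mxE; ring.
by exists (t * s); split; [nra | apply/rowP => i; rewrite !mxE; ring].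
Qed.

Lemma open_segment_beyond_trichotomy v w x y :
  in_open_segment v x w -> in_open_segment v y w ->
  [\/ x = y, in_open_segment y w x | in_open_segment x w y].
Proof.
move=> /open_segmentE[s s01 Ex] /open_segmentE[t t01 Ey].
have s0 : s != 0 by apply/negP => /eqP; lra.
have t0 : t != 0 by apply/negP => /eqP; lra.
(* On the ray from [v] with [w] at parameter 1, [x] and [y] sit at the inverse parameters, both
   beyond 1. *)
have -> : x = v + s^-1 *: (w - v).
  by rewrite Ex; apply/rowP => i; rewrite !mxE; field.
have -> : y = v + t^-1 *: (w - v).
  by rewrite Ey; apply/rowP => i; rewrite !mxE; field.
have s1 : 1 < s^-1 by rewrite invf_gt1; lra.
have t1 : 1 < t^-1 by rewrite invf_gt1; lra.
case: (ltgtP s^-1 t^-1) => st; [apply: Or32 | apply: Or33 | by apply: Or31; rewrite st];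
  apply/open_segment_sym; rewrite {1}(line_at1 v w); apply: open_segment_line; lra.
Qed.

Definition cross v w : R := v 0 0 * w 0 1 - v 0 1 * w 0 0.

(** As a vanishing determinant, this reduces many collinearity facts to [ring]. It holds for every
    [z] when [v = w], so extracting a parameter requires [v != w]. *)
Definition on_line v w z : Prop := cross (w - v) (z - v) = 0.

Lemma rV2_ext v w : v 0 0 = w 0 0 -> v 0 1 = w 0 1 -> v = w.
Proof.
move=> E0 E1; apply/rowP => i.
by case: (unliftP 0 i) => [j|] -> //; rewrite ord1 (_ : lift 0 0 = 1) //; apply: val_inj.
Qed.

Lemma on_lineP v w z : v != w -> on_line v w z ->
  exists t, z = v + t *: (w - v).
Proof.
rewrite /on_line /cross !mxE => vw E.
have [E0|n0] := eqVneq (w 0 0 - v 0 0) 0.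
  have [E1|n1] := eqVneq (w 0 1 - v 0 1) 0.
    by case/eqP: vw; apply: rV2_ext; apply/eqP; rewrite eq_sym -subr_eq0 ?E0 ?E1.
  exists ((z 0 1 - v 0 1) / (w 0 1 - v 0 1)); apply: rV2_ext; rewrite !mxE; last by field.
  move: E; rewrite E0 mul0r mulr0 addr0 sub0r => /eqP.
  by rewrite oppr_eq0 mulf_eq0 (negPf n1) /= subr_eq0 => /eqP.
exists ((z 0 0 - v 0 0) / (w 0 0 - v 0 0)); apply: rV2_ext; rewrite !mxE; first by field.
apply: (mulfI n0); apply/eqP; rewrite -subr_eq0; apply/eqP.
by rewrite -E; field.
Qed.

Lemma line_on_line o d r s t : on_line (o + r *: d) (o + s *: d) (o + t *: d).
Proof. by rewrite /on_line /cross !mxE; ring. Qed.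

Lemma open_segment_on_line v w z : in_open_segment v w z ->
  [/\ on_line v w z, on_line v z w & on_line w z v].
Proof.
move=> /open_segmentE[t _ ->].
by split; rewrite /on_line /cross !mxE; ring.
Qed.

Lemma on_line_between v w z : v != w -> v != z -> w != z -> on_line v w z ->
  [\/ in_open_segment v w z, in_open_segment v z w | in_open_segment w z v].
Proof.
move=> vw vz wz /(on_lineP vw)[t Ez].
have t0 : t != 0 by apply: contraNneq vz => t0; rewrite Ez t0 -line_at0.
have t1 : t != 1 by apply: contraNneq wz => t1; rewrite Ez t1 -line_at1.
rewrite {}Ez {vz wz}.
have L := open_segment_line v (w - v).
case: (ltgtP t 0) t0 => // ht _.
  apply/Or33/open_segment_sym; have := L t 0 1; rewrite -line_at0 -line_at1; apply; lra.
case: (ltgtP t 1) t1 => // ht1 _.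
  apply: Or31; have := L 0 t 1; rewrite -line_at0 -line_at1; apply; lra.
apply: Or32; have := L 0 1 t; rewrite -line_at0 -line_at1; apply; lra.
Qed.

Lemma open_segment_endr v w : in_open_segment v w w -> v = w.
Proof.
move=> /open_segmentE[t t01 /rowP E]; apply/rowP => i.
have /eqP := E i; rewrite !mxE -subr_eq0.
have -> : w 0 i - (v 0 i + t * (w 0 i - v 0 i)) = (1 - t) * (w 0 i - v 0 i) by ring.
rewrite mulf_eq0 => /orP[|] /eqP; first lra.
by move/eqP; rewrite subr_eq0 => /eqP.
Qed.

Lemma open_segment_endl v w : in_open_segment v w v -> v = w.
Proof. by move/open_segment_sym/open_segment_endr. Qed.

Lemma on_line_trans v w x y z : v != w ->
  on_line v w x -> on_line v w y -> on_line v w z -> on_line x y z.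
Proof.
move=> vw /(on_lineP vw)[r ->] /(on_lineP vw)[s ->] /(on_lineP vw)[t ->].
exact: line_on_line.
Qed.

Lemma on_line_left v w : on_line v w v.
Proof. by rewrite /on_line /cross !mxE; ring. Qed.

Lemma on_line_right v w : on_line v w w.
Proof. by rewrite /on_line /cross !mxE; ring. Qed.

(** The determinant is proportional to the signed distance from the line [vw], and moving from [x]
    towards [v] scales it by [t]. *)
Lemma open_segment_cross v w x z : in_open_segment v x z ->
  exists2 t, 0 < t < 1 & cross (w - v) (z - v) = t * cross (w - v) (x - v).
Proof.
by move=> /open_segmentE[t t01 ->]; exists t => //; rewrite /cross !mxE; ring.
Qed.

Lemma cross_swap v w z : cross (v - w) (z - w) = - cross (w - v) (z - v).
Proof. by rewrite /cross !mxE; ring. Qed.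

End Betweenness.

(** * The visibility graph and its diameter *)

Section VisibilityGraph.
Variables (R : realType) (P : {fset 'rV[R]_2}).
Implicit Types a b c v w x y z : P.

Local Notation vis := (@visibility_graph R P).
Local Notation between v w z := (in_open_segment (val v) (val w) (val z)).

Lemma visibilityP v w :
  reflect (v <> w /\ forall z, ~ between v w z) (vis v w).
Proof.
apply: (iffP (asboolP _)) => -[vw noz]; split.
- by move=> E; rewrite E eqxx in vw.
- by move=> z; apply: noz; apply: valP.
- by apply/eqP => /val_inj.
- by move=> z zP /(noz [` zP]%fset).
Qed.

Lemma visibility_sym : symmetric vis.
Proof.
suff imp v w : vis v w -> vis w v by move=> v w; apply/idP/idP; apply: imp.
move=> /visibilityP[vw noz]; apply/visibilityP; split=> [E|z]; first exact: vw.
by move/open_segment_sym; apply: noz.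
Qed.

Lemma visibility_irr : irreflexive vis.
Proof. by move=> v; apply/negP => /visibilityP[]. Qed.

(** Among [w] and the points between [v] and [w], choose [z] with the fewest points between [v] and
    [z]; a point blocking [z] would be a candidate with fewer. *)
Lemma first_visible v w : v != w ->
  exists2 z, vis v z & z = w \/ between v w z.
Proof.
move=> vw.
pose on z := `[< z = w \/ between v w z >].
have onw : on w by apply/asboolP; left.
pose m z := #|[set y : P | `[< between v z y >]]|.
case: (arg_minnP m onw) => z /asboolP onz minz; exists z => //.
have vz : v != z.
  apply: contra_neq vw => vz; case: onz => [<- //|]; rewrite -vz.
  by move/open_segment_endl/val_inj.
apply/visibilityP; split=> [|y yz]; first exact/eqP.
suff /minz : on y.
  apply/negP; rewrite -ltnNge; apply: proper_card; apply/properP; split.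
    apply/subsetP => x; rewrite !inE => /asboolP xy.
    by apply/asboolP; apply: open_segment_trans xy.
  exists y; rewrite !inE; apply/asboolP => // /open_segment_endr/val_inj E.
  by rewrite E in yz; move: yz => /open_segment_endl/val_inj/eqP; rewrite -E (negPf vz).
apply/asboolP; right; case: onz => [<- //|zw]; exact: open_segment_trans zw yz.
Qed.

(* The point off the line [vw] closest to it sees both [v] and [w]. *)
Lemma common_neighbour v w : ~ collinear P -> v != w ->
  exists2 z, vis v z & vis z w.
Proof.
move=> ncol vw.
have vvw : val v != val w by apply: contra_neq vw => /val_inj.
pose m z := cross (val w - val v) (val z - val v).
have [z0 mz0] : exists z, m z != 0.
  apply: contrapT => nex; apply: ncol; exists (val v), (val w - val v); split.
    by rewrite subr_eq0 eq_sym.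
  move=> z zP; apply: on_lineP => //; apply: contrapT => /eqP mz.
  by apply: nex; exists [` zP]%fset.
case: (arg_minP (fun z => `|m z|) (P := [pred z | m z != 0]) mz0).
move=> z /= mz minz.
(* A point whose determinant is a proper fraction of that of [z] is off the line and closer to it,
   against the choice of [z]. *)
have smaller y t : 0 < t < 1 -> m y = t * m z -> False.
  move=> t01 my; have t0 : t != 0 by apply/negP => /eqP; lra.
  have := minz y; rewrite my mulf_neq0 // normrM => /(_ isT).
  have := normr_gt0 (m z); rewrite mz (ger0_norm (x := t)); nra.
have zl u : on_line (val v) (val w) (val u) -> u <> z.
  by move=> lu E; rewrite -E /m lu eqxx in mz.
exists z.
  apply/visibilityP; split=> [|y]; first exact/zl/on_line_left.
  by move=> /(open_segment_cross (val w))[t t01]; apply: smaller.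
rewrite visibility_sym.
apply/visibilityP; split=> [|y]; first exact/zl/on_line_right.
move=> /(open_segment_cross (val v))[t t01].
by rewrite (cross_swap _ _ (val y)) (cross_swap _ _ (val z)) mulrN => /oppr_inj; apply: smaller.
Qed.

(** * Cuts in which a clique [A] sends one edge from each vertex *)

Section MatchingCut.
Variables (A : {set P}) (n : P -> P).
Hypotheses
  (clique : {in A &, forall a a', a != a' -> vis a a'})
  (n_notin : {in A, forall a, n a \notin A})
  (n_vis : {in A, forall a, vis a (n a)})
  (n_uniq : forall a b, a \in A -> b \notin A -> vis a b -> b = n a).

(* The points outside [A] on the ray from [a] through [n a]; for [a] in [A]
   these are the ones not hidden from [a] by another point of [A]. *)
Definition shadow a : {set P} :=
  [set b in ~: A | (b == n a) || `[< between a b (n a) >]].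

Lemma shadowP a b :
  reflect (b \notin A /\ (b = n a \/ between a b (n a))) (b \in shadow a).
Proof.
rewrite !inE; apply: (iffP andP) => -[bA h]; split => //.
  by case/orP: h => [/eqP|/asboolP]; [left | right].
by case: h => [->|h]; rewrite ?eqxx //; apply/orP; right; apply/asboolP.
Qed.

Lemma shadow_n a : a \in A -> n a \in shadow a.
Proof. by move=> aA; apply/shadowP; split; [exact: n_notin | left]. Qed.

Lemma shadow_notin a b : b \in shadow a -> b \notin A.
Proof. by case/shadowP. Qed.

Lemma clique_between a a' z : a \in A -> a' \in A -> a != a' -> ~ between a a' z.
Proof. by move=> aA a'A aa'; have /visibilityP[] := clique aA a'A aa'. Qed.

(** If [a'] were between [a] and [b], then of [a'] and [n a] the one nearer to [a] would hide the
    other from [a], although [a] sees both. *)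
Lemma shadow_unblocked a a' b :
  a \in A -> a' \in A -> b \in shadow a -> ~ between a b a'.
Proof.
move=> aA a'A /shadowP[bA onb] ba'.
have /visibilityP[_ vn] := n_vis aA.
case: onb => [E|bn]; first by apply: vn; rewrite -E; exact: ba'.
case: (open_segment_trichotomy bn ba') => [/val_inj E|h|h].
- by have := n_notin aA; rewrite E a'A.
- apply: (clique_between aA a'A _ h); apply: contraNneq bA => E.
  by move: ba'; rewrite -E => /open_segment_endl/val_inj <-.
- exact: vn h.
Qed.

(** The first point seen from [a] towards [b] is in [A], as otherwise it would be [n a]. If [b] were
    also hidden from this [a'] by some [a2] in [A], then [a'] would lie between [a] and [a2],
    against the clique. *)
Lemma shadow_blocker a b : a \in A -> b \notin A -> b \notin shadow a ->
  exists a', [/\ a' \in A, between a b a' & b \in shadow a'].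
Proof.
have first a1 b1 : a1 \in A -> b1 \notin A -> b1 \notin shadow a1 ->
    exists2 a', a' \in A & between a1 b1 a'.
  move=> aA bA bS; have ab : a1 != b1 by apply: contraNneq bA => <-.
  have [z vz onz] := first_visible ab.
  have [zA|zA] := boolP (z \in A).
    by exists z => //; case: onz => // E; rewrite -E zA in bA.
  case/negP: bS; apply/shadowP; split => //.
  by rewrite -(n_uniq aA zA vz); case: onz; [left | right].
move=> aA bA bS; have [a' a'A aa'] := first _ _ aA bA bS.
exists a'; split => //; apply/negPn/negP => bS'.
have [a2 a2A a'a2] := first _ _ a'A bA bS'.
apply: (clique_between aA a2A _ (open_segment_shorten aa' a'a2)).
(* If [a2 = a], the segment degenerates and [a' = a], which cannot lie strictly between [a] and
   [b]. *)
apply/eqP => E; have := open_segment_shorten aa' a'a2; rewrite -E.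
case=> t [_]; rewrite -scalerDl subrK scale1r => /val_inj E'.
move: aa'; rewrite E' => /open_segment_endl/val_inj E2.
by rewrite -E2 aA in bA.
Qed.

(** Together with [n_blocker]: [a'] hides from [a] either all of [shadow a'] or none of it, so
    [n a'] can stand for the whole shadow. *)
Lemma blocker_n a a' b : b \in shadow a' -> between a b a' -> between a (n a') a'.
Proof.
by case/shadowP=> _ [-> //|bn] ba'; apply: open_segment_shorten ba' bn.
Qed.

Lemma n_blocker a a' b : b \in shadow a' -> between a (n a') a' -> between a b a'.
Proof.
by case/shadowP=> _ [-> //|bn] ba'; apply: open_segment_extend ba' bn.
Qed.

Lemma between_neq a b z : a != b -> between a b z -> a != z.
Proof.
by move=> ab abz; apply: contra_neq ab => E; move: abz; rewrite -E => /open_segment_endl/val_inj.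
Qed.

(** Both points lie beyond [a'] on the ray from [n a']; if distinct, the nearer one would separate
    [a'] from the other inside the clique. *)
Lemma behind_uniq a1 a2 a' : a1 \in A -> a2 \in A -> a' \in A ->
  between a1 (n a') a' -> between a2 (n a') a' -> a1 = a2.
Proof.
move=> a1A a2A a'A h1 h2.
have ne a : a \in A -> between a (n a') a' -> a != a'.
  move=> aA; apply: between_neq; apply: contraTneq aA => ->; exact: n_notin.
case: (open_segment_beyond_trichotomy (open_segment_sym h1) (open_segment_sym h2)).
- exact: val_inj.
- by move/(clique_between a2A a'A (ne _ a2A h2)).
- by move/(clique_between a1A a'A (ne _ a1A h1)).
Qed.

Lemma shadow_on_line a b b' : a \in A -> b \in shadow a -> b' \in shadow a ->
  on_line (val b) (val b') (val a).
Proof.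
move=> aA.
have ana : val a != val (n a).
  by apply/eqP => /val_inj E; have := n_notin aA; rewrite -E aA.
have on c : c \in shadow a -> on_line (val a) (val (n a)) (val c).
  case/shadowP=> _ [->|/open_segment_on_line[_ ? _]] //; exact: on_line_right.
move=> /on h /on h'; exact: (on_line_trans ana h h' (on_line_left _ _)).
Qed.

(** Two common points would put [a], [a'] and [b] on one line. Then [b] between the others
    contradicts the clique, and [a] or [a'] in the middle contradicts [shadow_unblocked]. *)
Lemma shadow_meet a a' b b' : a \in A -> a' \in A -> a != a' ->
  b \in shadow a -> b' \in shadow a -> b \in shadow a' -> b' \in shadow a' ->
  b = b'.
Proof.
move=> aA a'A aa' bS b'S bS' b'S'; apply/eqP; apply: contraT => bb'.
have bA := shadow_notin bS.
have neq c d : c != d -> val c != val d by apply: contra_neq => /val_inj.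
have nb c : c \in A -> val c != val b.
  by move=> cA; apply: neq; apply: contraNneq bA => <-.
have := on_line_trans (neq _ _ bb') (shadow_on_line aA bS b'S)
  (shadow_on_line a'A bS' b'S') (on_line_left _ _).
case/(on_line_between (neq _ _ aa') (nb _ aA) (nb _ a'A)).
- by move/(clique_between aA a'A aa').
- by move/(shadow_unblocked aA a'A bS).
- by move/(shadow_unblocked a'A aA bS').
Qed.

(** Every other shadow is a singleton. Fix [a'] other than [a]: each point outside [A] except [n a']
    is hidden from [a'] by some [c] distinct from [a] and [a'], and equals [n c]. So [c] determines
    the point, and [#|~: A| - 1 <= #|A| - 2]. *)
Lemma full_shadow_card a : a \in A -> (1 < #|A|)%N ->
  shadow a = ~: A -> (#|~: A| < #|A|)%N.
Proof.
move=> aA A1 Sa.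
have [a' ] : exists a', a' \in A :\ a.
  by apply/card_gt0P; rewrite (cardsD1 a) aA in A1.
rewrite !inE => /andP[a'a a'A].
have inSa b : b \notin A -> b \in shadow a by rewrite Sa inE.
have single c b : c \in A -> c != a -> b \in shadow c -> b = n c.
  move=> cA ca bS; apply: (shadow_meet cA aA ca) => //; first exact: shadow_n.
    exact/inSa/(shadow_notin bS).
  exact/inSa/n_notin.
have blk b : exists c, b \in ~: A :\ n a' ->
    [/\ c \in A :\ a :\ a', c != a & b \in shadow c].
  have [|] := boolP (b \in ~: A :\ n a'); last by exists a.
  rewrite !inE => /andP[bn bA].
  have [c [cA a'bc bc]] : exists c, [/\ c \in A, between a' b c & b \in shadow c].
    apply: shadow_blocker => //; apply: contra bn => /(single _ _ a'A a'a) ->.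
    by rewrite eqxx.
  (* If [a] hid [b] from [a'], it would hide its whole shadow, including [n a']. *)
  have ca : c != a.
    apply/eqP => E; rewrite {c}E in cA a'bc bc.
    apply: (shadow_unblocked a'A aA (shadow_n a'A)).
    exact: n_blocker (inSa _ (n_notin a'A)) (blocker_n bc a'bc).
  have a'c : a' != c.
    by apply: between_neq a'bc; apply: contraNneq bA => <-.
  by exists c => _; split=> //; rewrite !inE eq_sym a'c ca.
have [h hP] := choice blk.
have inj : {in ~: A :\ n a' &, injective h}.
  move=> b b' /hP[h1 h2 h3] /hP[_ _ h4] E; rewrite -E in h4.
  by rewrite (single _ _ _ h2 h3) ?(single _ _ _ h2 h4) //; move: h1; rewrite !inE => /and3P[].
have sub : h @: (~: A :\ n a') \subset A :\ a :\ a'.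
  by apply/subsetP => _ /imsetP[b /hP[hb _ _] ->].
have := subset_leq_card sub; rewrite card_in_imset //.
rewrite (cardsD1 a A) aA (cardsD1 a' (A :\ a)) !inE a'a a'A (cardsD1 (n a') (~: A)).
by rewrite inE n_notin.
Qed.

Lemma matching_cut_collinear : (1 < #|A|)%N -> (#|A| <= #|~: A|)%N -> collinear P.
Proof.
move=> A1 AB.
(* No shadow is all of [~: A], by [full_shadow_card] and [AB], so some point is hidden from [a]. Off
   [A] the value is a dummy for [choice]. *)
have blk a : exists c, a \in A -> c \in A /\ between a (n c) c.
  have [aA|] := boolP (a \in A); last by exists a.
  have : shadow a != ~: A.
    by apply: contraTneq AB => /(full_shadow_card aA A1); rewrite -ltnNge.
  rewrite eqEsubset => /nandP[/subsetPn[b bS]|/subsetPn[b]].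
    by rewrite inE (shadow_notin bS).
  rewrite inE => bA /(shadow_blocker aA bA)[c [cA acb bc]].
  by exists c => _; split => //; exact: blocker_n acb.
have [g gP] := choice blk.
have gA a : a \in A -> g a \in A by case/gP.
have gb a : a \in A -> between a (n (g a)) (g a) by case/gP.
have gne a : a \in A -> a != g a.
  move=> aA; apply: between_neq (gb _ aA).
  by apply/eqP => E; have := n_notin (gA _ aA); rewrite -E aA.
have ginj : {in A &, injective g}.
  move=> a a' aA a'A E; apply: (behind_uniq aA a'A (gA _ aA)); first exact: gb.
  by rewrite E; exact: gb.
have gsurj : g @: A = A.
  apply/eqP; rewrite eqEcard card_in_imset // leqnn andbT.
  by apply/subsetP => _ /imsetP[a aA ->]; exact: gA.
have part a b : a \in A -> b \notin A -> (b \in shadow (g a)) = (b \notin shadow a).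
  move=> aA bA; apply/idP/idP => [bS|/(shadow_blocker aA bA)[c [cA acb bc]]].
    apply/negP => bSa; apply: (shadow_unblocked aA (gA _ aA) bSa).
    exact: n_blocker bS (gb _ aA).
  (* The blocker [c] is [g a1] for some [a1]; both [a] and [a1] are behind [c], so they coincide and
     [c = g a]. *)
  move: (cA); rewrite -gsurj => /imsetP[a1 a1A E].
  rewrite (_ : a = a1) -?E //; apply: (behind_uniq aA a1A cA).
    exact: blocker_n bc acb.
  by rewrite E; exact: gb.
have gg a : a \in A -> g (g a) = a.
  (* Otherwise [part], used twice, puts [shadow a] inside [shadow (g (g a))], so [shadow_meet]
     reduces it to [n a]; likewise for [g a]. Then [~: A] has at most two points, while [A] has the
     three points [a], [g a], [g (g a)]. *)
  move=> aA; apply/eqP; apply: contraT => ne.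
  have single c : c \in A -> g (g c) != c -> shadow c \subset [set n c].
    move=> cA gc; apply/subsetP => b bS; rewrite inE; apply/eqP.
    have in2 d : d \in shadow c -> d \in shadow (g (g c)).
      by move=> dS; rewrite !part ?gA ?(shadow_notin dS) // dS.
    have nS := shadow_n cA.
    by apply: (shadow_meet cA (gA _ (gA _ cA))); rewrite 1?eq_sym ?in2.
  have ne' : g (g (g a)) != g a.
    by apply: contra_neq ne => /ginj; apply; rewrite ?gA.
  have sub : ~: A \subset [set n a; n (g a)].
    apply/subsetP => b; rewrite inE => bA; rewrite !inE.
    have [/(subsetP (single _ aA ne))|bS] := boolP (b \in shadow a).
      by rewrite inE => ->.
    move: bS; rewrite -part // => /(subsetP (single _ (gA _ aA) ne')).
    by rewrite inE => ->; rewrite orbT.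
  have sub3 : [set g (g a); a; g a] \subset A.
    by apply/subsetP => x; rewrite !inE => /orP[/orP[]|] /eqP ->; rewrite ?gA.
  have := leq_trans (subset_leq_card sub3) (leq_trans AB (subset_leq_card sub)).
  rewrite cards2 -setUA cardsU1 cards2 !inE gne // negb_or ne eq_sym gne ?gA //.
  by case: (_ != _).
have line a b : a \in A -> b \notin A -> on_line (val a) (val (g a)) (val b).
  (* Since [g] is an involution, [a] and [g a] hide their shadows from each other. *)
  move=> aA bA; have [bS|] := boolP (b \in shadow a).
    have : between (g a) b a.
      by apply: n_blocker bS _; rewrite -{2 3}(gg _ aA); exact/gb/gA.
    by case/open_segment_on_line => _ _; rewrite /on_line /cross !mxE => E; rewrite -[RHS]E; ring.
  rewrite -part // => bS.
  by have /open_segment_on_line[] := n_blocker bS (gb _ aA).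
have [b [b' [bA b'A bb']]] : exists b b', [/\ b \notin A, b' \notin A & b != b'].
  have /card_gt1P[b [b' []]] := leq_trans A1 AB; rewrite !inE.
  by move=> bA b'A bb'; exists b, b'.
have neq c d : c != d -> val c != val d by apply: contra_neq => /val_inj.
have [a aA] : exists a, a \in A by apply/card_gt0P; exact: ltnW.
(* For [c] in [A], the line through [c] and [g c] contains [b] and [b']; for [c] outside, use the
   line through [a] and [g a]. *)
have all c : on_line (val b) (val b') (val c).
  have [cA|cA] := boolP (c \in A).
    by apply: (on_line_trans (neq _ _ (gne _ cA))); [exact: line | exact: line | exact: on_line_left].
  by apply: (on_line_trans (neq _ _ (gne _ aA))); exact: line.
exists (val b), (val b' - val b); split; first by rewrite subr_eq0 eq_sym neq.
by move=> z zP; apply: on_lineP (neq _ _ bb') (all [` zP]%fset).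
Qed.

End MatchingCut.
End VisibilityGraph.

(** * One side of a minimum cut is a single vertex *)

Lemma visibility_cut_trivial (R : realType) (P : {fset 'rV[R]_2}) (A : {set P}) :
  ~ collinear P ->
  (forall v, #|boundary (@visibility_graph R P) A| <=
             #|nbrs_in (@visibility_graph R P) setT v|)%N ->
  {in A, forall v, (0 < #|nbrs_in (@visibility_graph R P) (~: A) v|)%N} ->
  (#|A| <= 1)%N \/ (#|~: A| <= 1)%N.
Proof.
move=> ncol deg nb.
have [A1|] := ltnP 1 #|A|; last by left.
have [B1|] := ltnP 1 #|~: A|; last by right.
have irr := @visibility_irr R P; have sym := @visibility_sym R P.
have [cA clique one] := matching_boundary irr deg A1 nb.
have nP a : exists b, a \in A -> nbrs_in (@visibility_graph R P) (~: A) a = [set b].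
  have [/one/eqP/cards1P[b E]|] := boolP (a \in A); last by exists a.
  by exists b.
have [n nE] := choice nP.
have nin a : a \in A -> n a \in nbrs_in (@visibility_graph R P) (~: A) a.
  by move=> aA; rewrite (nE _ aA) inE.
case: ncol; apply: (@matching_cut_collinear R P A n) => //.
- by move=> a /nin; rewrite !inE => /andP[].
- by move=> a /nin; rewrite inE => /andP[].
- by move=> a b aA bA ab; apply/set1P; rewrite -(nE _ aA) !inE bA.
(* The complement has the same boundary, so the counting bound applies to it as well and gives
   [#|A| <= #|~: A|]. *)
- rewrite -cA -boundaryC //; apply: card_boundary_le => // v.
  by rewrite boundaryC.
Qed.

Theorem theorem6 (R : realType) (P : {fset 'rV[R]_2}) (F : {set {set P}}) :
  ~ collinear P ->
  minimum_edge_cut (@visibility_graph R P) F ->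
  exists v : P, F = incident_edges (@visibility_graph R P) v.
Proof.
move=> ncol minF.
have irr := @visibility_irr R P; have sym := @visibility_sym R P.
have [A [A0 B0 FE]] := minimum_edge_cut_boundary minF.
have deg v : (#|F| <= #|nbrs_in (@visibility_graph R P) setT v|)%N.
  (* The degree bound needs a vertex other than [v]: [x], or else [y] from the other side. *)
  have [x xA] := set0Pn _ A0; have [y yA] := set0Pn _ B0.
  have [E|vx] := eqVneq v x; last exact: minimum_edge_cut_degree minF vx.
  apply: (@minimum_edge_cut_degree _ _ _ _ y) minF _.
  by apply: contraTneq yA => <-; rewrite inE E xA.
suff : (#|A| <= 1)%N \/ (#|~: A| <= 1)%N.
  have single (X : {set P}) : X != set0 -> (#|X| <= 1)%N -> exists v, X = [set v].
    by rewrite -card_gt0 => X0 X1; apply/cards1P; rewrite eqn_leq X1.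
  case=> [/(single _ A0)|/(single _ B0)] [v E]; exists v.
    by rewrite FE E boundary1.
  by rewrite FE -boundaryC // E boundary1.
have [/forall_inP nbA|/forall_inPn[a aA na]] :=
  boolP [forall v in A, (0 < #|nbrs_in (@visibility_graph R P) (~: A) v|)%N].
  by apply: visibility_cut_trivial => // v; rewrite -FE.
(* Here [a] has no neighbour outside [A], so a common neighbour of [a] and any [b] outside lies in
   [A]: the sides can be exchanged. *)
suff : (#|~: A| <= 1)%N \/ (#|~: ~: A| <= 1)%N by rewrite setCK => -[]; [right | left].
apply: visibility_cut_trivial => // [v|b]; first by rewrite boundaryC // -FE.
rewrite setCK => bB; apply/card_gt0P.
have ab : a != b by apply: contraTneq bB => <-; rewrite inE aA.
have [z az zb] := common_neighbour ncol ab.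
exists z; rewrite !inE sym zb andbT.
apply: contraT => zA; case/negP: na; apply/card_gt0P.
by exists z; rewrite !inE zA.
Qed.
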